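(* Let $0\le\alpha<\omega_1$ and let $K$ be a compact Hausdorff space whose Cantor–Bendixson derived sets satisfy $K^{(\omega^\alpha)}\neq\emptyset$ and $K^{(\omega^{\alpha+1})}=\emptyset$. Then $\mathrm{Dz}(C(K))=\omega^{1+\alpha+1}$.
   Context: Derived sets: $K^{(0)}=K$, $K^{(\beta+1)}$ is the set of accumulation points of $K^{(\beta)}$, $K^{(\beta)}=\bigcap_{\mu<\beta}K^{(\mu)}$ for limit $\beta$. $C(K)$ is the sup-normed space of real continuous functions on $K$. For a real Banach space $X$: $H(x,t)=\{x^*\in X^*: x^*(x)>t\}$; a weak$^*$-slice of a weak$^*$-compact $L\subset X^*$ is a nonempty $H(x,t)\cap L$; $d_\varepsilon L$ is $L$ minus the union of all weak$^*$-slices of $L$ of norm diameter $<\varepsilon$; $d_\varepsilon^0L=L$, $d_\varepsilon^{\beta+1}L=d_\varepsilon(d_\varepsilon^\beta L)$, $d_\varepsilon^\beta L=\bigcap_{\mu<\beta}d_\varepsilon^\mu L$ for limit $\beta$. $\mathrm{Dz}(X,\varepsilon)$ is the least ordinal $\beta$ with $d_\varepsilon^\beta B_{X^*}=\emptyset$ (or $\infty$), and $\mathrm{Dz}(X)=\sup_{\varepsilon>0}\mathrm{Dz}(X,\varepsilon)$. Ordinal arithmetic throughout. *)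

(* Defs.v *)
From Stdlib Require Import Reals List.
Open Scope R_scope.

(* Countable ordinals as Brouwer trees.                               *)
(* Every tree denotes a countable ordinal and every countable ordinal *)
(* (i.e. every ordinal < omega_1) is denoted by some tree.            *)
Inductive Ord : Type :=
| OZ : Ord
| OS : Ord -> Ord
| OL : (nat -> Ord) -> Ord.   (* OL f denotes sup_n f n *)

Inductive ole : Ord -> Ord -> Prop :=
| ole_Z b : ole OZ b
| ole_SS a b : ole a b -> ole (OS a) (OS b)
| ole_S_r a b : ole a b -> ole a (OS b)
| ole_L_r a f n : ole a (f n) -> ole a (OL f)
| ole_L_l f b : (forall n, ole (f n) b) -> ole (OL f) b
| ole_trans a b c : ole a b -> ole b c -> ole a c.

Definition olt (a b : Ord) : Prop := ole (OS a) b.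

Fixpoint ofin (n : nat) : Ord :=
  match n with O => OZ | Datatypes.S m => OS (ofin m) end.

Definition oone : Ord := OS OZ.
Definition omega : Ord := OL ofin.

Fixpoint oadd (a b : Ord) : Ord :=
  match b with
  | OZ => a
  | OS b' => OS (oadd a b')
  | OL f => OL (fun n => oadd a (f n))
  end.

Fixpoint omul (a b : Ord) : Ord :=
  match b with
  | OZ => OZ
  | OS b' => oadd (omul a b') a
  | OL f => OL (fun n => omul a (f n))
  end.

(* a ^ b, correct for a >= 1 (used only with a = omega) *)
Fixpoint oexp (a b : Ord) : Ord :=
  match b with
  | OZ => oone
  | OS b' => omul (oexp a b') a
  | OL f => OL (fun n => oexp a (f n))
  end.

(* Transfinite iteration of a set operator d starting from A:
   d^0 A = A, d^(b+1) A = d (d^b A), limit = intersection.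
   (All operators used below are decreasing, d X ⊆ X, so the limit
   clause over a cofinal sequence agrees with the intersection over
   all smaller ordinals.) *)
Fixpoint titer {X : Type} (d : (X -> Prop) -> (X -> Prop)) (A : X -> Prop)
  (b : Ord) : X -> Prop :=
  match b with
  | OZ => A
  | OS b' => d (titer d A b')
  | OL f => fun x => forall n, titer d A (f n) x
  end.

Record is_topology {K : Type} (op : (K -> Prop) -> Prop) : Prop := {
  top_full : op (fun _ => True);
  top_inter : forall U V, op U -> op V -> op (fun x => U x /\ V x);
  top_union : forall F : (K -> Prop) -> Prop,
      (forall U, F U -> op U) -> op (fun x => exists U, F U /\ U x)
}.

Definition hausdorff {K : Type} (op : (K -> Prop) -> Prop) : Prop :=
  forall x y : K, x <> y ->
    exists U V, op U /\ op V /\ U x /\ V y /\ (forall z, U z -> V z -> False).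

Definition compact_sp {K : Type} (op : (K -> Prop) -> Prop) : Prop :=
  forall F : (K -> Prop) -> Prop,
    (forall U, F U -> op U) -> (forall x, exists U, F U /\ U x) ->
    exists l : list (K -> Prop),
      (forall U, In U l -> F U) /\ (forall x, exists U, In U l /\ U x).

Definition cb_deriv {K : Type} (op : (K -> Prop) -> Prop) (A : K -> Prop) : K -> Prop :=
  fun x => forall U, op U -> U x -> exists y, U y /\ A y /\ y <> x.

Definition cb_set {K : Type} (op : (K -> Prop) -> Prop) (b : Ord) : K -> Prop :=
  titer (cb_deriv op) (fun _ => True) b.

Definition continuous_on {K : Type} (op : (K -> Prop) -> Prop) (f : K -> R) : Prop :=
  forall x eps, 0 < eps ->
    exists U, op U /\ U x /\ forall y, U y -> Rabs (f y - f x) < eps.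

Definition CK {K : Type} (op : (K -> Prop) -> Prop) : Type :=
  { f : K -> R | continuous_on op f }.

Definition ck_fun {K} {op : (K -> Prop) -> Prop} (f : CK op) : K -> R := proj1_sig f.

Definition in_unit_ball {K} {op : (K -> Prop) -> Prop} (f : CK op) : Prop :=
  forall k, Rabs (ck_fun f k) <= 1.

Definition is_linear {K} {op : (K -> Prop) -> Prop} (phi : CK op -> R) : Prop :=
  (forall f g h : CK op, (forall k, ck_fun h k = ck_fun f k + ck_fun g k) ->
     phi h = phi f + phi g) /\
  (forall (c : R) (f h : CK op), (forall k, ck_fun h k = c * ck_fun f k) ->
     phi h = c * phi f).

Definition dual_ball {K} (op : (K -> Prop) -> Prop) : (CK op -> R) -> Prop :=
  fun phi => is_linear phi /\ forall f, in_unit_ball f -> Rabs (phi f) <= 1.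

Definition diam_lt {K} {op : (K -> Prop) -> Prop} (S : (CK op -> R) -> Prop) (eps : R) : Prop :=
  exists delta, delta < eps /\
    forall phi psi, S phi -> S psi ->
      forall f, in_unit_ball f -> Rabs (phi f - psi f) <= delta.

Definition slice {K} {op : (K -> Prop) -> Prop} (L : (CK op -> R) -> Prop)
  (x : CK op) (t : R) : (CK op -> R) -> Prop :=
  fun phi => L phi /\ phi x > t.

Definition d_eps {K} {op : (K -> Prop) -> Prop} (eps : R) (L : (CK op -> R) -> Prop)
  : (CK op -> R) -> Prop :=
  fun phi => L phi /\
    ~ (exists x t, (exists psi, slice L x t psi) /\ diam_lt (slice L x t) eps
                   /\ slice L x t phi).

Definition Dz_eps_is {K} (op : (K -> Prop) -> Prop) (eps : R) (b : Ord) : Prop :=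
  (forall phi, ~ titer (d_eps eps) (dual_ball op) b phi) /\
  (forall mu, olt mu b -> exists phi, titer (d_eps eps) (dual_ball op) mu phi).

(* Dz(C(K)) = g : g = sup_{eps>0} Dz(C(K), eps) (all of which are ordinals,
   not infinity) *)
Definition Dz_is {K} (op : (K -> Prop) -> Prop) (g : Ord) : Prop :=
  (forall eps, 0 < eps -> exists b, Dz_eps_is op eps b /\ ole b g) /\
  (forall d, (forall eps b, 0 < eps -> Dz_eps_is op eps b -> ole b d) -> ole g d).

(* Main.v *)
Require Import Defs.
From Stdlib Require Import Reals List Lra Lia Classical FunctionalExtensionality PropExtensionality.
From HB Require Import structures.
From mathcomp Require all_boot order ssralg ssrnum interval boolp classical_sets reals.
From mathcomp Require topology num_normedtype pseudometric_normed_Zmodule normed_module urysohn Rstruct.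

(** Write s = omega^alpha.

    Lower bound. Suppose nu + r delta_y lies in a weak*-closed convex set L for every y, with |r| >= eps. If x is an
    accumulation point of the derived set K^(b), dyadic averages of 2^n functionals nu + r delta_y with y in K^(b)
    near x survive n dentability derivations, because siblings of the dyadic tree are 2|r| apart; letting y tend
    to x, nu + r delta_x survives omega of them. Inductively nu + r delta_x survives omega b derivations when x is in
    K^(b). Using +r and -r and taking the midpoint, nu itself survives omega s derivations when K^(s) is nonempty.
    With eps = r = 1/N this shrinks the dual ball by 1/N at each block of omega s derivations, so 0 survives N blocks.

    Upper bound. Let Q be a weak*-continuous functional such that the elements of L in [{Q > t}] differ by at most e < eps
    off a closed set W. If W^(omega^a) is empty, omega^(1+a) derivations remove [{Q > t + tau}] from L, by induction on
    a: if the closed set F in W is the derived set of order omega^a n, replace Q by the convex potential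
    Q + c |.|(K \ F). Near its supremum over L a functional has almost all its mass on F together with a closed
    set disjoint from F, a part of W of smaller rank, so a fixed ordinal number of derivations lowers
    the supremum by a fixed amount; finitely many repetitions suffice. Atoms of a finite W are treated in the same way
    with the potential Q + c phi(f)^2, f a bump at the atom. *)

(** * Urysohn's lemma *)

Module UrysohnBridge.
Import all_boot order ssralg ssrnum interval boolp classical_sets reals.
Import topology num_normedtype pseudometric_normed_Zmodule normed_module urysohn Rstruct.
Import Order.TTheory GRing.Theory Num.Theory numFieldNormedType.Exports.
Local Open Scope classical_set_scope.

Section Top.
Variables (K : Type) (op : (K -> Prop) -> Prop) (Htop : is_topology op).

(** A copy of [K] indexed by the proof [Htop]: the type alone then determines the topology, as
    canonical structures require. *)
Definition space of is_topology op : Type := K.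
Local Notation T := (space Htop).

HB.instance Definition _ := gen_eqMixin T.
HB.instance Definition _ := gen_choiceMixin T.

Lemma op_setT : op setT. Proof. exact: (top_full _ Htop). Qed.
Lemma op_setI : setI_closed op.
Proof. move=> A B; exact: (top_inter _ Htop). Qed.
Lemma op_bigcup (I : Type) (f : I -> set K) :
  (forall i, op (f i)) -> op (\bigcup_i f i).
Proof.
move=> opf; have -> : \bigcup_i f i = fun x => exists U, (exists i, U = f i) /\ U x.
  apply/seteqP; split=> x /=; first by case=> i _ ?; exists (f i); split=> //; exists i.
  by case=> _ [[i ->] ?]; exists i.
by apply: (top_union _ Htop) => _ [i ->].
Qed.
HB.instance Definition _ := isOpenTopological.Build T op_setT op_setI op_bigcup.

Lemma space_hausdorff : hausdorff op -> hausdorff_space T.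
Proof.
move=> H p q cl; apply: contrapT => /H [U [V [oU [oV [Up [Vq UV]]]]]].
have [|z [Uz Vz]] := cl U V _ (open_nbhs_nbhs (conj (oV : open (V : set T)) Vq)).
  exact: (open_nbhs_nbhs (conj (oU : open (U : set T)) Up)).
exact: UV Uz Vz.
Qed.

(** If a filter had no cluster point, the open sets missing some member of it would cover the space.
    A finite subcover then gives finitely many members with empty intersection. *)
Lemma space_compact : compact_sp op -> compact [set: T].
Proof.
move=> H F FF _; apply: contrapT => ncl.
have [|x|l [lop lcov]] := H (fun U => op U /\ exists2 A, F A & A `&` U = set0).
- by move=> U [].
- apply: contrapT => nU; apply: ncl; exists x; split=> // A B FA.
  rewrite nbhsE => -[C [oC Cx] CB]; apply: contrapT => AB0; apply: nU; exists C.
  do 2!split=> //; exists A => //; rewrite -subset0 => y [Ay Cy].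
  by apply: AB0; exists y; split=> //; exact: CB.
suff F0 : F set0 by exact: (@filter_not_empty _ F _ F0).
have : exists2 A, F A & forall U, In U l -> A `&` U = set0.
  elim: l lop {lcov} => [_|U l IHl lop]; first by exists setT => //; exact: filterT.
  have [V Vl|A FA AP] := IHl; first by apply: lop; right.
  have [_ [B FB BU]] := lop U (or_introl erefl).
  exists (A `&` B); first exact: filterI.
  move=> V /= [<-|/AP AV]; rewrite -subset0 => y [[Ay By] Vy].
    by rewrite -BU.
  by rewrite -AV.
case=> A FA AP; suff <- : A = set0 by [].
rewrite -subset0 => y Ay; have [U [Ul Uy]] := lcov y.
by rewrite -(AP U Ul).
Qed.

Lemma realType_urysohn (R : realType) : hausdorff op -> compact_sp op -> forall A B : K -> Prop,
  op (fun x => ~ A x) -> op (fun x => ~ B x) -> (forall x, A x -> B x -> False) ->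
  exists f : K -> R,
    (forall x e, 0 < e -> exists U, op U /\ U x /\ forall y, U y -> `|f x - f y| < e)%R /\
    (forall x, 0 <= f x <= 1)%R /\ (forall x, A x -> f x = 0%R) /\ (forall x, B x -> f x = 1%R).
Proof.
move=> hT cT A B cA cB AB.
have /(@normal_separatorP R T) := compact_normal (space_hausdorff hT) (space_compact cT).
move=> /(_ A B) H.
have {H} : @uniform_separator T A B.
  apply: H; first by rewrite -openC.
    by rewrite -openC.
  by rewrite -subset0 => x [/AB].
move=> /(@uniform_separatorP T R A B) [f [cf f01 fA fB]].
exists f; split; last split; last split.
- move=> x e e0; have /cvgrPdist_lt/(_ _ e0) := cf x.
  by rewrite nbhsE => -[U [oU Ux] Uf]; exists U; split=> //; split=> // y /Uf.
- move=> x; have := f01 (f x) (ex_intro2 _ _ x I erefl).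
  by rewrite /= in_itv.
- by move=> x Ax; have := fA (f x) (ex_intro2 _ _ x Ax erefl).
- by move=> x Bx; have := fB (f x) (ex_intro2 _ _ x Bx erefl).
Qed.

Lemma urysohn : hausdorff op -> compact_sp op -> forall A B : K -> Prop,
  op (fun x => ~ A x) -> op (fun x => ~ B x) -> (forall x, A x -> B x -> False) ->
  exists f : K -> Rdefinitions.R, continuous_on op f /\ (forall x, Rle R0 (f x) /\ Rle (f x) R1) /\
    (forall x, A x -> f x = R0) /\ (forall x, B x -> f x = R1).
Proof.
move=> hT cT A B cA cB AB.
have [f [cf [f01 [fA fB]]]] := realType_urysohn Rdefinitions.R hT cT A B cA cB AB.
exists f; split; last split=> //.
- move=> x e /RltP e0; have [U [oU [Ux Uf]]] := cf x e e0.
  by exists U; split=> //; split=> // y /Uf /RltP; rewrite Rabs_minus_sym.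
- by move=> x; have /andP[/RleP ? /RleP ?] := f01 x.
Qed.
End Top.
End UrysohnBridge.

(** * Ordinals *)

Lemma ole_refl a : ole a a.
Proof.
induction a as [|a IH|f IH]; [apply ole_Z|now apply ole_SS|].
apply ole_L_l; intro n; now apply ole_L_r with n.
Qed.

Lemma ole_S a : ole a (OS a).
Proof. apply ole_S_r, ole_refl. Qed.

Lemma ole_sup f n : ole (f n) (OL f).
Proof. apply ole_L_r with n, ole_refl. Qed.

(* The predecessors of a tree, computed without appeal to [ole_trans]; this is what makes [ole] invertible. *)
Fixpoint below (a : Ord) : Ord -> Prop :=
  match a with
  | OZ => fun _ => False
  | OS b => fun x => ole x b
  | OL f => fun x => exists n, below (f n) x
  end.

Lemma below_ole a x : below a x -> ole (OS x) a.
Proof.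
induction a as [|a IH|f IH]; simpl.
- easy.
- apply ole_SS.
- intros [n Hn]; apply ole_L_r with n; auto.
Qed.

Lemma below_mono a b : ole a b -> forall x, below a x -> below b x.
Proof.
induction 1 as [b|a b H IH|a b H IH|a f n H IH|f b H IH|a b c H1 IH1 H2 IH2]; simpl; intros x Hx.
- easy.
- now apply ole_trans with a.
- apply ole_trans with (OS x); [apply ole_S|now apply below_ole, IH].
- exists n; auto.
- destruct Hx as [n Hn]; now apply (IH n).
- auto.
Qed.

Lemma olt_below a b : olt a b -> below b a.
Proof. intro H; apply (below_mono _ _ H); simpl; apply ole_refl. Qed.

Lemma olt_S_inv a b : olt a (OS b) -> ole a b.
Proof. exact (olt_below a (OS b)). Qed.

Lemma olt_Z_inv a : ~ olt a OZ.
Proof. exact (olt_below a OZ). Qed.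

Lemma olt_sup_inv a f : olt a (OL f) -> exists n, olt a (f n).
Proof. intro H; destruct (olt_below _ _ H) as [n Hn]; exists n; now apply below_ole. Qed.

Lemma forall_or_exists_not (P : nat -> Prop) : (forall n, P n) \/ exists n, ~ P n.
Proof. destruct (classic (forall n, P n)); [now left|right; now apply not_all_ex_not]. Qed.

(* Both orders of the arguments are needed at once: comparing a successor with a supremum calls the swapped comparison. *)
Lemma ole_olt_total_sym a :
  forall b, (ole a b \/ olt b a) /\ (ole b a \/ olt a b).
Proof.
induction a as [|a IH|f IH].
- intro b; split; [left; apply ole_Z|].
  induction b as [|b IHb|g IHb].
  + left; apply ole_Z.
  + right; apply ole_SS, ole_Z.
  + destruct (forall_or_exists_not (fun n => ole (g n) OZ)) as [H|[n Hn]].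
    * left; now apply ole_L_l.
    * right; destruct (IHb n) as [H|H]; [easy|]; now apply ole_L_r with n.
- assert (R : forall b, ole b (OS a) \/ olt (OS a) b).
  { induction b as [|b IHb|g IHb].
    - left; apply ole_Z.
    - destruct (proj2 (IH b)); [left|right]; now apply ole_SS.
    - destruct (forall_or_exists_not (fun n => ole (g n) (OS a))) as [H|[n Hn]].
      + left; now apply ole_L_l.
      + right; destruct (IHb n) as [H|H]; [easy|]; now apply ole_L_r with n. }
  intro b; split; [|apply R].
  destruct b as [|b|g].
  + right; apply ole_SS, ole_Z.
  + destruct (proj1 (IH b)); [left|right]; now apply ole_SS.
  + destruct (classic (exists n, ole (OS a) (g n))) as [[n Hn]|H].
    * left; now apply ole_L_r with n.
    * right; apply ole_SS, ole_L_l; intro n.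
      destruct (proj2 (IH (g n))) as [H1|H1]; [easy|].
      exfalso; apply H; now exists n.
- assert (Q : forall b, ole (OL f) b \/ olt b (OL f)).
  { intro b; destruct (forall_or_exists_not (fun n => ole (f n) b)) as [H|[n Hn]].
    - left; now apply ole_L_l.
    - right; destruct (proj1 (IH n b)) as [H|H]; [easy|]; now apply ole_L_r with n. }
  intro b; split; [apply Q|].
  induction b as [|b IHb|g IHb].
  + left; apply ole_Z.
  + destruct (Q b) as [H|H]; [right; now apply ole_SS|now left].
  + destruct (forall_or_exists_not (fun n => ole (g n) (OL f))) as [H|[n Hn]].
    * left; now apply ole_L_l.
    * right; destruct (IHb n) as [H|H]; [easy|]; now apply ole_L_r with n.
Qed.

Lemma ole_olt_total a b : ole a b \/ olt b a.
Proof. apply ole_olt_total_sym. Qed.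

Lemma ole_total a b : ole a b \/ ole b a.
Proof.
destruct (ole_olt_total a b) as [H|H]; [now left|right].
apply ole_trans with (OS b); [apply ole_S|exact H].
Qed.

(** Well-foundedness, by structural induction on the bound. At a successor either some witness lies
    below the predecessor or the given witness is already minimal. *)
Lemma ord_least (P : Ord -> Prop) b :
  (exists c, ole c b /\ P c) ->
  exists c, ole c b /\ P c /\ forall mu, olt mu c -> ~ P mu.
Proof.
induction b as [|b IH|f IH]; intros [c [Hc Pc]].
- exists c; repeat split; auto; intros mu Hmu _.
  apply (olt_Z_inv mu); now apply ole_trans with c.
- destruct (classic (exists c, ole c b /\ P c)) as [H|H].
  + destruct (IH H) as (d & Hd & Pd & Md); exists d; repeat split; auto; now apply ole_S_r.
  + exists c; repeat split; auto; intros mu Hmu Pmu; apply H; exists mu; split; auto.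
    apply olt_S_inv; now apply ole_trans with c.
- destruct (classic (exists n c, ole c (f n) /\ P c)) as [[n H]|H].
  + destruct (IH n H) as (d & Hd & Pd & Md); exists d; repeat split; auto; now apply ole_L_r with n.
  + exists c; repeat split; auto; intros mu Hmu Pmu; apply H.
    destruct (olt_sup_inv mu f) as [n Hn]; [now apply ole_trans with c|].
    exists n, mu; split; auto; apply ole_trans with (OS mu); [apply ole_S|exact Hn].
Qed.

Lemma oadd_mono_r a b b' : ole b b' -> ole (oadd a b) (oadd a b').
Proof.
induction 1 as [b|b c H IH|b c H IH|b f n H IH|f b H IH|b c d H1 IH1 H2 IH2]; simpl.
- induction b as [|b IH|f IH]; simpl; [apply ole_refl|now apply ole_S_r|].
  now apply ole_L_r with 0%nat.
- now apply ole_SS.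
- now apply ole_S_r.
- now apply ole_L_r with n.
- now apply ole_L_l.
- now apply ole_trans with (oadd a c).
Qed.

Lemma oadd_mono_l a a' b : ole a a' -> ole (oadd a b) (oadd a' b).
Proof.
intro H; induction b as [|b IH|f IH]; simpl; [easy|now apply ole_SS|].
apply ole_L_l; intro n; now apply ole_L_r with n.
Qed.

Lemma oadd_Z_l b : ole (oadd OZ b) b /\ ole b (oadd OZ b).
Proof.
induction b as [|b IH|f IH]; simpl; split; try apply ole_Z; try now apply ole_SS.
- apply ole_L_l; intro n; apply ole_L_r with n, IH.
- apply ole_L_l; intro n; apply ole_L_r with n, IH.
Qed.

(** As recursion runs on the right argument, both sides agree as trees, not only as ordinals. The
    same holds for [omul_oadd] and [omul_assoc], which can thus be used for rewriting. *)
Lemma oadd_assoc a b c : oadd (oadd a b) c = oadd a (oadd b c).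
Proof.
induction c as [|c IH|f IH]; simpl; [easy|now rewrite IH|].
f_equal; extensionality n; auto.
Qed.

Lemma omul_mono_l a a' b : ole a a' -> ole (omul a b) (omul a' b).
Proof.
intro H; induction b as [|b IH|f IH]; simpl; [apply ole_Z| |].
- apply ole_trans with (oadd (omul a' b) a); [now apply oadd_mono_l|now apply oadd_mono_r].
- apply ole_L_l; intro n; now apply ole_L_r with n.
Qed.

Lemma omul_oadd a b c : omul a (oadd b c) = oadd (omul a b) (omul a c).
Proof.
induction c as [|c IH|f IH]; simpl; [easy| |].
- now rewrite IH, oadd_assoc.
- f_equal; extensionality n; auto.
Qed.

Lemma omul_assoc a b c : omul (omul a b) c = omul a (omul b c).
Proof.
induction c as [|c IH|f IH]; simpl; [easy| |].
- now rewrite IH, omul_oadd.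
- f_equal; extensionality n; auto.
Qed.

Lemma omul_one a : ole (omul a oone) a /\ ole a (omul a oone).
Proof. apply oadd_Z_l. Qed.

Lemma omul_ofin_mono a n m : (n <= m)%nat -> ole (omul a (ofin n)) (omul a (ofin m)).
Proof.
induction 1 as [|m _ IH]; [apply ole_refl|simpl].
apply ole_trans with (1 := IH); apply (oadd_mono_r _ OZ), ole_Z.
Qed.

Lemma ofin_mul n m : omul (ofin n) (ofin m) = ofin (n * m).
Proof.
assert (A : forall p q, oadd (ofin p) (ofin q) = ofin (p + q)).
{ intros p q; induction q as [|q IH]; simpl.
  - now rewrite Nat.add_0_r.
  - now rewrite IH, Nat.add_succ_r. }
induction m as [|m IH]; simpl; [now rewrite Nat.mul_0_r|].
rewrite IH, A; f_equal; lia.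
Qed.

(** The lower bound arrives as [omega * omega^alpha], the theorem has the exponent [1 + alpha]. Both
    follow the same recursion in [alpha], so only the base case [1 * omega <= omega * 1] needs a
    calculation. *)
Lemma omega_pow_one_add alpha :
  ole (oexp omega (oadd oone alpha)) (omul omega (oexp omega alpha)).
Proof.
induction alpha as [|a IH|f IH]; simpl oadd.
- apply ole_trans with omega; [|apply (omul_one omega)].
  apply ole_L_l; intro n; change (ole (omul (oadd oone OZ) (ofin n)) omega).
  change (oadd oone OZ) with (ofin 1); rewrite ofin_mul; apply ole_sup.
- change (ole (omul (oexp omega (oadd oone a)) omega) (omul omega (omul (oexp omega a) omega))).
  rewrite <- omul_assoc; now apply omul_mono_l.
- simpl oexp; apply ole_L_l; intro n; simpl; now apply ole_L_r with n.
Qed.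

(** * Transfinite iteration of set operators *)

Section Iteration.
Context {X : Type} (d : (X -> Prop) -> (X -> Prop)).
Hypothesis d_mono : forall A B : X -> Prop, (forall x, A x -> B x) -> forall x, d A x -> d B x.

Lemma titer_subset A B b : (forall x, A x -> B x) -> forall x, titer d A b x -> titer d B b x.
Proof.
intro H; induction b as [|b IH|f IH]; simpl; [easy|now apply d_mono|].
intros x Hx n; now apply IH.
Qed.

Lemma titer_oadd A a b : titer d A (oadd a b) = titer d (titer d A a) b.
Proof.
induction b as [|b IH|f IH]; simpl; [easy|now rewrite IH|].
extensionality x; apply propositional_extensionality; split; intros H n; specialize (H n).
- now rewrite <- IH.
- now rewrite IH.
Qed.

(** Decrease is demanded only along the orbit of [A], because [cb_deriv] shrinks closed sets but not
    arbitrary ones. *)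
Lemma titer_antitone A a b :
  (forall c x, titer d A (OS c) x -> titer d A c x) ->
  ole a b -> forall x, titer d A b x -> titer d A a x.
Proof.
intros D H; induction H as [b|a b H IH|a b H IH|a f n H IH|f b H IH|a b c H1 IH1 H2 IH2]; intros x Hx.
- induction b as [|b IH|f IH]; [easy|now apply IH, D|exact (IH 0%nat (Hx 0%nat))].
- simpl in *; now apply d_mono with (titer d A b).
- now apply IH, D.
- exact (IH x (Hx n)).
- intro n; now apply IH.
- now apply IH1, IH2.
Qed.
End Iteration.

(** * Derived sets and continuous functions *)

Section Space.
Context {K : Type} {op : (K -> Prop) -> Prop}.
Hypothesis Htop : is_topology op.

Definition closed (A : K -> Prop) : Prop := op (fun x => ~ A x).

Lemma op_ext (U V : K -> Prop) : op U -> (forall x, U x <-> V x) -> op V.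
Proof.
intros HU E; replace V with U; [easy|].
extensionality x; apply propositional_extensionality, E.
Qed.

Lemma op_local (U : K -> Prop) :
  (forall x, U x -> exists V, op V /\ V x /\ forall y, V y -> U y) -> op U.
Proof.
intro H; apply op_ext with (fun x => exists V, (op V /\ forall y, V y -> U y) /\ V x).
- apply (top_union _ Htop); now intros V [HV _].
- intro x; split; [intros (V & [_ HV] & Vx); auto|].
  intro Ux; destruct (H x Ux) as (V & HV & Vx & VU); now exists V.
Qed.

Lemma op_union2 U V : op U -> op V -> op (fun x => U x \/ V x).
Proof.
intros HU HV; apply op_local; intros x [H|H]; [exists U|exists V]; auto.
Qed.

Lemma closed_complement U : op U -> closed (fun x => ~ U x).
Proof. intro H; apply op_ext with (1 := H); intro x; split; [tauto|apply NNPP]. Qed.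

Lemma closed_union A B : closed A -> closed B -> closed (fun x => A x \/ B x).
Proof.
intros HA HB; apply op_ext with (1 := top_inter _ Htop _ _ HA HB); intro x; tauto.
Qed.

Lemma closed_inter A B : closed A -> closed B -> closed (fun x => A x /\ B x).
Proof.
intros HA HB; apply op_ext with (1 := op_union2 _ _ HA HB); intro x; tauto.
Qed.

Lemma closed_full : closed (fun _ => True).
Proof. apply op_local; intros x Hx; now destruct Hx. Qed.

Lemma closed_empty : closed (fun _ => False).
Proof. apply op_ext with (1 := top_full _ Htop); tauto. Qed.

Lemma closed_forall (A : nat -> K -> Prop) :
  (forall n, closed (A n)) -> closed (fun x => forall n, A n x).
Proof.
intro H; apply op_local; intros x Hx.
apply not_all_ex_not in Hx; destruct Hx as [n Hn].
exists (fun y => ~ A n y); repeat split; [apply H|easy|]; intros y Hy F; exact (Hy (F n)).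
Qed.

Lemma cb_deriv_mono (A B : K -> Prop) :
  (forall x, A x -> B x) -> forall x, cb_deriv op A x -> cb_deriv op B x.
Proof.
intros H x Hx U HU Ux; destruct (Hx U HU Ux) as (y & Uy & Ay & N); exists y; auto.
Qed.

Lemma cb_deriv_subset A : closed A -> forall x, cb_deriv op A x -> A x.
Proof.
intros HA x Hx; apply NNPP; intro N.
now destruct (Hx _ HA N) as (y & Ny & Ay & _).
Qed.

(** Derivation is local: neighbourhoods of a point of [O] can be shrunk into [O]. *)
Lemma titer_cb_local (O A B : K -> Prop) b :
  op O -> (forall x, O x -> A x -> B x) ->
  forall x, O x -> titer (cb_deriv op) A b x -> titer (cb_deriv op) B b x.
Proof.
intros HO H; induction b as [|b IH|f IH]; simpl; intros x Ox Hx; [auto| |now intro n; apply IH].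
intros U HU Ux; destruct (Hx (fun y => U y /\ O y)) as (y & [Uy Oy] & Ay & N);
  [now apply (top_inter _ Htop)|easy|exists y; auto].
Qed.

Hypothesis Hhaus : hausdorff op.

Lemma closed_point p : closed (fun x => x = p).
Proof.
apply op_local; intros x Hx.
destruct (Hhaus x p Hx) as (U & V & HU & HV & Ux & Vp & D).
exists U; repeat split; auto; intros y Uy ->; now apply (D p).
Qed.

Lemma closed_list l : closed (fun x => In x l).
Proof.
induction l as [|p l IH]; simpl; [apply closed_empty|].
apply closed_union; [|exact IH].
apply op_ext with (1 := closed_point p); intro x; split; intros H E; now apply H.
Qed.

(** An open [U] that meets [A] at most in [x] contains no accumulation point of [A]: for [y <> x]
    remove the closed point [x] from [U]. *)
Lemma closed_cb_deriv A : closed (cb_deriv op A).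
Proof.
apply op_local; intros x Hx.
apply not_all_ex_not in Hx; destruct Hx as [U HU].
apply imply_to_and in HU; destruct HU as [HU H].
apply imply_to_and in H; destruct H as [Ux H].
exists U; repeat split; auto; intros y Uy Hy.
destruct (classic (y = x)) as [->|N].
- now apply H, Hy.
- destruct (Hy (fun z => U z /\ z <> x)) as (z & [Uz Nz] & Az & _); auto.
  + apply (top_inter _ Htop); [easy|apply closed_point].
  + apply H; now exists z.
Qed.

Lemma closed_titer_cb A b : closed A -> closed (titer (cb_deriv op) A b).
Proof.
intro HA; destruct b as [|b|f]; simpl; [easy|apply closed_cb_deriv|].
apply closed_forall; intro n.
induction (f n) as [|b IH|g IH]; simpl; [easy|apply closed_cb_deriv|now apply closed_forall].
Qed.

Lemma titer_cb_antitone A a b : closed A -> ole a b ->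
  forall x, titer (cb_deriv op) A b x -> titer (cb_deriv op) A a x.
Proof.
intro HA; apply (titer_antitone _ cb_deriv_mono).
intros c x Hx; apply cb_deriv_subset with (2 := Hx); now apply closed_titer_cb.
Qed.

Lemma accumulation_list A x n U : cb_deriv op A x -> op U -> U x ->
  exists l, length l = n /\ NoDup l /\ forall y, In y l -> U y /\ A y.
Proof.
intros Hx HU Ux.
(* Keeping [x] itself out of the list makes the complement of the list a neighbourhood of [x], from
   which the next point is drawn. *)
enough (exists l, length l = n /\ NoDup l /\ forall y, In y l -> U y /\ A y /\ y <> x) as (l & H1 & H2 & H3).
{ exists l; repeat split; auto; now apply H3. }
induction n as [|n (l & Hl & ND & H)]; [exists nil; repeat split; try constructor; easy|].
destruct (Hx (fun y => U y /\ ~ In y l)) as (y & [Uy Ny] & Ay & N).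
- apply (top_inter _ Htop); [easy|apply closed_list].
- split; auto; intro I; now apply (H x I).
- exists (y :: l); split; [simpl; now rewrite Hl|split; [now constructor|]].
  intros z [<-|Hz]; auto.
Qed.

Hypothesis Hcomp : compact_sp op.

(** Brings emptiness of a derived set at a limit stage down to an earlier stage. Pairwise
    comparability replaces monotonicity because the sequence under [OL] need not increase. *)
Lemma compact_chain (A : nat -> K -> Prop) :
  (forall n, closed (A n)) ->
  (forall m n, (forall x, A m x -> A n x) \/ (forall x, A n x -> A m x)) ->
  (forall x, exists n, ~ A n x) -> exists n, forall x, ~ A n x.
Proof.
intros HA Hc He.
destruct (Hcomp (fun U => exists n, U = fun x => ~ A n x)) as (l & Hl & Cl).
- intros U [n ->]; apply HA.
- intro x; destruct (He x) as [n Hn]; exists (fun x => ~ A n x); eauto.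
- assert (exists n, forall U, In U l -> forall x, U x -> ~ A n x) as [n Hn].
  { clear Cl; induction l as [|U l IH]; [exists 0%nat; intros ? []|].
    destruct IH as [n Hn]; [intros V HV; apply Hl; now right|].
    destruct (Hl U (or_introl eq_refl)) as [m ->].
    destruct (Hc m n) as [H|H]; [exists m|exists n]; intros V [<-|HV] x Vx Ax.
    - now apply Vx.
    - exact (Hn V HV x Vx (H x Ax)).
    - now apply Vx, H.
    - exact (Hn V HV x Vx Ax). }
  exists n; intro x; destruct (Cl x) as (U & HU & Ux); eauto.
Qed.

(** Every point of [K] has a neighbourhood with at most one point of [W]; finitely many of these
    cover [K]. *)
Lemma discrete_closed_finite W : (forall x, ~ cb_deriv op W x) ->
  exists l, forall x, W x -> In x l.
Proof.
intro HW.
destruct (Hcomp (fun U => op U /\ exists p, forall x, U x -> W x -> x = p)) as (l & Hl & Cl).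
- now intros U [HU _].
- intro x; specialize (HW x).
  apply not_all_ex_not in HW; destruct HW as [U HU].
  apply imply_to_and in HU; destruct HU as [HU H].
  apply imply_to_and in H; destruct H as [Ux H].
  exists U; repeat split; auto; exists x; intros y Uy Wy; apply NNPP; intro N.
  apply H; now exists y.
- enough (exists m, forall U x, In U l -> U x -> W x -> In x m) as [m Hm].
  { exists m; intros x Wx; destruct (Cl x) as (U & HU & Ux); eauto. }
  clear Cl; induction l as [|U l IH]; [exists nil; intros ? ? []|].
  destruct IH as [m Hm]; [intros V HV; apply Hl; now right|].
  destruct (Hl U (or_introl eq_refl)) as [_ [p Hp]].
  exists (p :: m); intros V x [<-|HV] Vx Wx; [left; symmetry; auto|right; eauto].
Qed.

(** * Continuous functions and linear functionals *)

Lemma continuous_const c : continuous_on op (fun _ => c).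
Proof.
intros x e He; exists (fun _ => True); repeat split; [apply (top_full _ Htop)|].
intros y _; rewrite Rminus_diag, Rabs_R0; lra.
Qed.

Lemma continuous_plus f g : continuous_on op f -> continuous_on op g ->
  continuous_on op (fun x => f x + g x).
Proof.
intros Hf Hg x e He.
destruct (Hf x (e / 2)) as (U & HU & Ux & H1); [lra|].
destruct (Hg x (e / 2)) as (V & HV & Vx & H2); [lra|].
exists (fun y => U y /\ V y); repeat split; auto; [now apply (top_inter _ Htop)|].
intros y [Uy Vy]; specialize (H1 y Uy); specialize (H2 y Vy).
replace (f y + g y - (f x + g x)) with ((f y - f x) + (g y - g x)) by ring.
pose proof (Rabs_triang (f y - f x) (g y - g x)); lra.
Qed.

Lemma continuous_mult f g : continuous_on op f -> continuous_on op g ->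
  continuous_on op (fun x => f x * g x).
Proof.
intros Hf Hg x e He.
pose proof (Rabs_pos (f x)) as Pf; pose proof (Rabs_pos (g x)) as Pg.
assert (E1 : 0 < Rmin 1 (e / (2 * (Rabs (f x) + 1)))).
{ apply Rmin_pos; [lra|apply Rdiv_lt_0_compat; lra]. }
assert (E2 : 0 < e / (2 * (Rabs (g x) + 1))) by (apply Rdiv_lt_0_compat; lra).
destruct (Hf x _ E2) as (U & HU & Ux & H1).
destruct (Hg x _ E1) as (V & HV & Vx & H2).
exists (fun y => U y /\ V y); repeat split; auto; [now apply (top_inter _ Htop)|].
intros y [Uy Vy]; specialize (H1 y Uy); specialize (H2 y Vy).
assert (A1 : Rabs (g y - g x) < 1) by (eapply Rlt_le_trans; [exact H2|apply Rmin_l]).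
assert (A2 : Rabs (g y - g x) < e / (2 * (Rabs (f x) + 1))) by (eapply Rlt_le_trans; [exact H2|apply Rmin_r]).
replace (f y * g y - f x * g x) with ((f y - f x) * g y + f x * (g y - g x)) by ring.
eapply Rle_lt_trans; [apply Rabs_triang|rewrite !Rabs_mult].
assert (B : Rabs (g y) <= Rabs (g x) + 1).
{ replace (g y) with (g x + (g y - g x)) by ring; eapply Rle_trans; [apply Rabs_triang|lra]. }
assert (C1 : Rabs (f y - f x) * Rabs (g y) < e / 2).
{ apply Rle_lt_trans with (Rabs (f y - f x) * (Rabs (g x) + 1)).
  - apply Rmult_le_compat_l; [apply Rabs_pos|easy].
  - replace (e / 2) with (e / (2 * (Rabs (g x) + 1)) * (Rabs (g x) + 1)) by (field; lra).
    apply Rmult_lt_compat_r; lra. }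
assert (C2 : Rabs (f x) * Rabs (g y - g x) <= e / 2).
{ apply Rle_trans with ((Rabs (f x) + 1) * (e / (2 * (Rabs (f x) + 1)))).
  - apply Rmult_le_compat; try apply Rabs_pos; lra.
  - right; field; lra. }
lra.
Qed.

Lemma op_near (f : K -> R) a e : continuous_on op f -> op (fun y => Rabs (f y - a) < e).
Proof.
intro Hf; apply op_local; intros y Hy.
destruct (Hf y (e - Rabs (f y - a))) as (U & HU & Uy & H); [lra|].
exists U; repeat split; auto; intros z Uz; specialize (H z Uz).
replace (f z - a) with ((f z - f y) + (f y - a)) by ring.
pose proof (Rabs_triang (f z - f y) (f y - a)); lra.
Qed.

Definition ck_const c : CK op := exist _ _ (continuous_const c).
Definition ck_add (f g : CK op) : CK op :=
  exist _ _ (continuous_plus _ _ (proj2_sig f) (proj2_sig g)).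
Definition ck_mul (f g : CK op) : CK op :=
  exist _ _ (continuous_mult _ _ (proj2_sig f) (proj2_sig g)).
Definition ck_scale c (f : CK op) : CK op := ck_mul (ck_const c) f.

(** Elements of [CK op] carry a continuity proof; homogeneity with factor 1 lets functionals ignore
    it. *)
Lemma lin_ext (phi : CK op -> R) f g :
  is_linear phi -> (forall k, ck_fun f k = ck_fun g k) -> phi f = phi g.
Proof.
intros [_ H] E; rewrite (H 1 g f); [ring|intro k; rewrite E; ring].
Qed.

Lemma lin_comb (phi : CK op -> R) a b f g h :
  is_linear phi -> (forall k, ck_fun h k = a * ck_fun f k + b * ck_fun g k) ->
  phi h = a * phi f + b * phi g.
Proof.
intros [H1 H2] E.
rewrite (H1 (ck_scale a f) (ck_scale b g) h); [|intro k; apply E].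
now rewrite (H2 a f (ck_scale a f) (fun _ => eq_refl)), (H2 b g (ck_scale b g) (fun _ => eq_refl)).
Qed.

Lemma lin_sub (phi psi : CK op -> R) :
  is_linear phi -> is_linear psi -> is_linear (fun f => phi f - psi f).
Proof.
intros [A1 A2] [B1 B2]; split.
- intros f g h E; rewrite (A1 f g h E), (B1 f g h E); ring.
- intros c f h E; rewrite (A2 c f h E), (B2 c f h E); ring.
Qed.

Lemma dual_ball_bound phi (f : CK op) s : dual_ball op phi -> 0 < s ->
  (forall k, Rabs (ck_fun f k) <= s) -> Rabs (phi f) <= s.
Proof.
intros [L B] Hs H.
assert (A : Rabs (phi (ck_scale (/ s) f)) <= 1).
{ apply B; intro k; change (Rabs (/ s * ck_fun f k) <= 1).
  rewrite Rabs_mult, Rabs_inv, (Rabs_right s); [|lra].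
  apply Rmult_le_reg_l with s; [lra|].
  rewrite <- Rmult_assoc, Rinv_r, Rmult_1_l; [specialize (H k); lra|lra]. }
replace (phi f) with (s * phi (ck_scale (/ s) f)).
- rewrite Rabs_mult, (Rabs_right s); [|lra].
  nra.
- rewrite (proj2 L (/ s) f (ck_scale (/ s) f) (fun _ => eq_refl)); field; lra.
Qed.

(** Zero on a neighbourhood of [A], not just on [A]: the support is then a closed set disjoint from
    [A], which leaves room for Urysohn's lemma. *)
Definition vanishes_near (z : CK op) (A : K -> Prop) : Prop :=
  exists U, op U /\ (forall x, A x -> U x) /\ forall x, U x -> ck_fun z x = 0.

Lemma separating_function A B : closed A -> closed B -> (forall x, A x -> B x -> False) ->
  exists h : CK op, (forall x, 0 <= ck_fun h x <= 1) /\ vanishes_near h A /\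
    exists V, op V /\ (forall x, B x -> V x) /\ forall x, V x -> ck_fun h x = 1.
Proof.
intros HA HB D.
destruct (UrysohnBridge.urysohn K op Htop Hhaus Hcomp A B HA HB D) as (f & Cf & Rf & FA & FB).
(* The ramp is 0 up to 1/3 and 1 from 2/3 on, which makes the composite constant near [A] and near
   [B]. *)
set (c := fun t => Rmax 0 (Rmin 1 (3 * t - 1))).
assert (Lc : forall a b, Rabs (c a - c b) <= 3 * Rabs (a - b)).
{ intros a b; unfold c, Rmax, Rmin, Rabs; repeat destruct Rle_dec; repeat destruct Rcase_abs; lra. }
assert (Cc : continuous_on op (fun x => c (f x))).
{ intros x e He; destruct (Cf x (e / 3)) as (U & HU & Ux & H); [lra|].
  exists U; repeat split; auto; intros y Uy; specialize (H y Uy); specialize (Lc (f y) (f x)); lra. }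
exists (exist _ _ Cc); unfold ck_fun; simpl; split; [|split].
- intro x; unfold c, Rmax, Rmin; repeat destruct Rle_dec; lra.
- exists (fun x => Rabs (f x - 0) < / 3); repeat split.
  + now apply op_near.
  + intros x Ax; rewrite (FA x Ax), Rminus_diag, Rabs_R0; lra.
  + intros x Hx; unfold ck_fun; simpl; unfold c, Rmax, Rmin, Rabs in *.
    destruct Rcase_abs; repeat destruct Rle_dec; lra.
- exists (fun x => Rabs (f x - 1) < / 3); repeat split.
  + now apply op_near.
  + intros x Bx; rewrite (FB x Bx), Rminus_diag, Rabs_R0; lra.
  + intros x Hx; unfold c, Rmax, Rmin, Rabs in *.
    destruct Rcase_abs; repeat destruct Rle_dec; lra.
Qed.

(** * Upper bound *)

Lemma Rabs_le_bounds x a : Rabs x <= a -> - a <= x <= a.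
Proof. unfold Rabs; destruct Rcase_abs; lra. Qed.

Definition small (theta : CK op -> R) (C : K -> Prop) (e : R) : Prop :=
  forall z, in_unit_ball z -> vanishes_near z C -> theta z <= e.

Definition conc (W : K -> Prop) (e : R) (phi psi : CK op -> R) : Prop :=
  small (fun f => phi f - psi f) W e.

Lemma vanishes_near_mono z A B : (forall x, A x -> B x) -> vanishes_near z B -> vanishes_near z A.
Proof. intros H (U & HU & BU & E); exists U; repeat split; auto. Qed.

Lemma small_mono theta C D e : (forall x, C x -> D x) -> small theta C e -> small theta D e.
Proof. intros H S z Hz V; apply S; auto; now apply vanishes_near_mono with D. Qed.

Lemma in_unit_ball_mul (h z : CK op) :
  (forall x, 0 <= ck_fun h x <= 1) -> in_unit_ball z -> in_unit_ball (ck_mul h z).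
Proof.
intros Hh Hz k; change (Rabs (ck_fun h k * ck_fun z k) <= 1).
rewrite Rabs_mult, (Rabs_right (ck_fun h k)); [|specialize (Hh k); lra].
specialize (Hh k); specialize (Hz k); pose proof (Rabs_pos (ck_fun z k)); nra.
Qed.

Definition ck_compl (h : CK op) : CK op := ck_add (ck_const 1) (ck_scale (-1) h).

Lemma ck_complE h k : ck_fun (ck_compl h) k = 1 - ck_fun h k.
Proof. change (1 + -1 * ck_fun h k = 1 - ck_fun h k); ring. Qed.

(* Subadditivity of the variation on open sets: [small theta C e] says that |theta| has mass at most e off C. *)
Lemma small_inter theta C D e1 e2 : is_linear theta -> closed C -> closed D ->
  small theta C e1 -> small theta D e2 -> small theta (fun x => C x /\ D x) (e1 + e2).
Proof.
intros L HC HD SC SD z Hz (N & HN & SN & EN).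
(* Off [N], where [z] may be nonzero, [C] and [D] are disjoint; [h] splits [z] into a part vanishing
   near [C] and a part vanishing near [D]. *)
destruct (separating_function (fun x => C x /\ ~ N x) (fun x => D x /\ ~ N x))
  as (h & Rh & (U & HU & CU & EU) & (V & HV & DV & EV)).
- apply closed_inter; [easy|now apply closed_complement].
- apply closed_inter; [easy|now apply closed_complement].
- intros x [Cx Nx] [Dx _]; apply Nx, SN; now split.
- rewrite (lin_comb theta 1 1 (ck_mul h z) (ck_mul (ck_compl h) z) z L).
  + rewrite !Rmult_1_l; apply Rplus_le_compat; [apply SC|apply SD].
    * now apply in_unit_ball_mul.
    * exists (fun x => N x \/ U x); repeat split; [now apply op_union2| |].
      { intros x Cx; destruct (classic (N x)); auto. }
      intros x [Nx|Ux]; change (ck_fun h x * ck_fun z x = 0).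
      { rewrite (EN x Nx); ring. }
      rewrite (EU x Ux); ring.
    * apply in_unit_ball_mul; [intro x; rewrite ck_complE; specialize (Rh x); lra|easy].
    * exists (fun x => N x \/ V x); repeat split; [now apply op_union2| |].
      { intros x Dx; destruct (classic (N x)); auto. }
      intros x [Nx|Vx]; change (ck_fun (ck_compl h) x * ck_fun z x = 0).
      { rewrite (EN x Nx); ring. }
      rewrite ck_complE, (EV x Vx); ring.
  + intro k; change (ck_fun z k = 1 * (ck_fun h k * ck_fun z k) + 1 * (ck_fun (ck_compl h) k * ck_fun z k)).
    rewrite ck_complE; ring.
Qed.

Lemma unit_ball_opp (z : CK op) : in_unit_ball z -> in_unit_ball (ck_scale (-1) z).
Proof.
intros H k; change (Rabs (-1 * ck_fun z k) <= 1).
replace (-1 * ck_fun z k) with (- ck_fun z k) by ring; rewrite Rabs_Ropp; apply H.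
Qed.

Lemma vanishes_near_scale c z A : vanishes_near z A -> vanishes_near (ck_scale c z) A.
Proof.
intros (U & HU & AU & E); exists U; repeat split; auto.
intros x Ux; change (c * ck_fun z x = 0); rewrite (E x Ux); ring.
Qed.

Lemma lin_scale (phi : CK op -> R) c z : is_linear phi -> phi (ck_scale c z) = c * phi z.
Proof. intros [_ H]; now apply H. Qed.

Lemma conc_of_small phi psi D k : is_linear phi -> is_linear psi ->
  small phi D k -> small psi D k -> conc D (2 * k) phi psi.
Proof.
intros L1 L2 S1 S2 z Hz V.
pose proof (S1 z Hz V) as A.
pose proof (S2 _ (unit_ball_opp z Hz) (vanishes_near_scale (-1) z D V)) as B.
rewrite (lin_scale psi _ _ L2) in B; lra.
Qed.

(** Here [r] is the a priori excess of [Q] over [t] and [tau] the excess that remains. Quantifying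
    over [L], [Q] and [t] allows a restart on a derived set with a modified functional. *)
Definition kill (eps : R) (E : (CK op -> R) -> (CK op -> R) -> Prop) (g : Ord) (tau r : R) : Prop :=
  forall (L : (CK op -> R) -> Prop) (Q : CK op) (t : R),
    (forall phi, L phi -> dual_ball op phi) ->
    (forall phi, L phi -> phi Q <= t + r) ->
    (forall phi psi, L phi -> L psi -> phi Q > t -> psi Q > t -> E phi psi) ->
    forall phi, titer (d_eps eps) L g phi -> phi Q <= t + tau.

(** [M] must not depend on [E], because [potential_step] meets a different relation for each [y]. *)
Definition uniformly_killed (eps : R) (C : ((CK op -> R) -> (CK op -> R) -> Prop) -> Prop) (s : Ord) : Prop :=
  forall tau r, 0 < tau ->
    exists M : nat, forall E, C E -> kill eps E (omul s (ofin M)) tau r.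

Lemma d_eps_mono eps (A B : (CK op -> R) -> Prop) :
  (forall phi, A phi -> B phi) -> forall phi, d_eps eps A phi -> d_eps eps B phi.
Proof.
intros H phi [Ap N]; split; [auto|].
intros (x & t & _ & (dl & Hd & D) & [_ Hx]); apply N.
exists x, t; split; [exists phi; now split|split; [|now split]].
exists dl; split; [easy|]; intros p q [Hp1 Hp2] [Hq1 Hq2] f Hf; apply D; try split; auto.
Qed.

Lemma d_eps_subset eps (A : (CK op -> R) -> Prop) phi : d_eps eps A phi -> A phi.
Proof. now intros [H _]. Qed.

Lemma titer_d_antitone eps (A : (CK op -> R) -> Prop) a b :
  ole a b -> forall phi, titer (d_eps eps) A b phi -> titer (d_eps eps) A a phi.
Proof. apply (titer_antitone _ (d_eps_mono eps)); intros c x; apply d_eps_subset. Qed.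

Lemma titer_d_subset eps (A : (CK op -> R) -> Prop) b phi : titer (d_eps eps) A b phi -> A phi.
Proof. exact (titer_d_antitone eps A OZ b (ole_Z b) phi). Qed.

Lemma kill_later eps E a b tau r : ole a b -> kill eps E a tau r -> kill eps E b tau r.
Proof.
intros H KE L Q t H1 H2 H3 phi Hphi; apply (KE L Q t); auto.
now apply titer_d_antitone with b.
Qed.

Lemma kill_weaken eps (E E' : (CK op -> R) -> (CK op -> R) -> Prop) a tau r :
  (forall phi psi, E phi psi -> E' phi psi) -> kill eps E' a tau r -> kill eps E a tau r.
Proof. intros H KE L Q t H1 H2 H3; apply (KE L Q t); auto. Qed.

(* A pair (f, c) stands for the weak*-continuous affine function phi |-> phi f - c. *)
Definition nearly_max (Y : CK op * R -> Prop) (y : CK op * R) (k : R) (phi : CK op -> R) : Prop :=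
  forall y', Y y' -> phi (fst y') - snd y' <= phi (fst y) - snd y + k.

(* The sup over [y] of [Q + a y] is a convex potential. Where [Q + a y] comes within [a k] of its supremum, both
   [Q > t] and [nearly_max Y y k] hold, so the hypothesis on [C'] lowers that supremum by [a k / 2]; finitely many
   rounds bring it down to [t + 3 a + a k], whence [Q <= t + tau]. *)
Lemma potential_step eps C' s k : 0 < k <= 1 -> uniformly_killed eps C' s ->
  forall tau r, 0 < tau -> exists M : nat, forall E Y,
    (exists y, Y y) ->
    (forall y phi, Y y -> dual_ball op phi -> Rabs (phi (fst y) - snd y) <= 3) ->
    (forall y, Y y -> exists E', C' E' /\ forall phi psi, dual_ball op phi -> dual_ball op psi ->
        E phi psi -> nearly_max Y y k phi -> nearly_max Y y k psi -> E' phi psi) ->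
    kill eps E (omul s (ofin M)) tau r.
Proof.
intros Hk HC tau r Htau.
(* The affine terms are bounded by 3 on the dual ball, so passing between [Q] and [Q + a y] costs
   [3 a] each way, and [6 a + dl <= 7 a < tau]. *)
set (a := tau / 8); set (dl := k * a).
assert (Ha : 0 < a) by (unfold a; lra).
assert (Hdl : 0 < dl) by (unfold dl; nra).
assert (Hda : dl <= a) by (unfold dl; nra).
(* A round starts at most [dl] above its threshold and ends at most [dl / 2] above it; [J] such
   gains consume the excess [r]. *)
destruct (HC (dl / 2) dl) as [M HM]; [lra|].
destruct (INR_unbounded (r / (dl / 2))) as [J HJ].
assert (HJ' : r <= INR J * (dl / 2)).
{ apply Rmult_le_reg_r with (/ (dl / 2)); [apply Rinv_0_lt_compat; lra|].
  rewrite Rmult_assoc, Rinv_r, Rmult_1_r; [unfold Rdiv in HJ at 1; lra|lra]. }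
exists (M * J)%nat; intros E Y [y0 Hy0] HB HE.
rewrite <- ofin_mul, <- omul_assoc; set (sM := omul s (ofin M)).
intros L Q t HL HQ HLE.
(* The floor [t + 3 a + dl] ensures that a potential above the maximum minus [dl] still forces
   [Q > t]. *)
assert (key : forall j phi, titer (d_eps eps) L (omul sM (ofin j)) phi ->
  forall y, Y y -> phi Q + a * (phi (fst y) - snd y) <= Rmax (t + r + 3 * a - INR j * (dl / 2)) (t + 3 * a + dl)).
{ induction j as [|j IH]; intros phi Hphi y Hy.
  - simpl in Hphi; eapply Rle_trans; [|apply Rmax_l]; simpl INR.
    specialize (HQ phi Hphi); pose proof (HB y phi Hy (HL phi Hphi)) as B.
    apply Rabs_le_bounds in B; nra.
  - simpl in Hphi; rewrite titer_oadd in Hphi.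
    set (Lj := titer (d_eps eps) L (omul sM (ofin j))) in *.
    set (q := Rmax (t + r + 3 * a - INR j * (dl / 2)) (t + 3 * a + dl)) in *.
    assert (Hq : t + 3 * a + dl <= q) by apply Rmax_r.
    destruct (HE y Hy) as (E' & CE' & HE').
    assert (sub : forall p, Lj p -> L p) by (intro p; apply titer_d_subset).
    assert (Qy : forall p, Lj p -> p (ck_add Q (ck_scale a (fst y))) = p Q + a * p (fst y)).
    { intros p Hp; rewrite (lin_comb p 1 a Q (fst y)); [ring|apply (HL p), sub, Hp|].
      intro x; change (ck_fun Q x + a * ck_fun (fst y) x = 1 * ck_fun Q x + a * ck_fun (fst y) x); ring. }
    assert (G : phi (ck_add Q (ck_scale a (fst y))) <= q - dl + a * snd y + dl / 2).
    { apply (HM E' CE' Lj) with (phi := phi); [auto| | |easy].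
      - intros p Hp; rewrite Qy; [|easy]; specialize (IH p Hp y Hy); nra.
      - assert (N : forall p, Lj p -> p (ck_add Q (ck_scale a (fst y))) > q - dl + a * snd y ->
            p Q > t /\ nearly_max Y y k p).
        { intros p Hp Gp; rewrite Qy in Gp; [|easy]; split.
          - pose proof (HB y p Hy (HL p (sub p Hp))) as B; apply Rabs_le_bounds in B; nra.
          - intros y' Hy'; pose proof (IH p Hp y' Hy') as I; unfold dl in *.
            apply Rmult_le_reg_l with a; [lra|]; nra. }
        intros p p' Hp Hp' Gp Gp'; destruct (N p Hp Gp), (N p' Hp' Gp').
        apply HE'; auto. }
    rewrite Qy in G; [|apply titer_d_subset with (1 := Hphi)].
    rewrite S_INR; unfold q in *; clear -G Hdl.
    unfold Rmax in *; repeat destruct Rle_dec; nra. }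
intros phi Hphi.
pose proof (key J phi Hphi y0 Hy0) as G.
pose proof (HB y0 phi Hy0 (HL phi (titer_d_subset _ _ _ _ Hphi))) as B; apply Rabs_le_bounds in B.
assert (phi Q + a * (phi (fst y0) - snd y0) <= t + 3 * a + dl).
{ eapply Rle_trans; [exact G|]; apply Rmax_lub; lra. }
unfold a in *; nra.
Qed.

(** For closed [F] the supremum of [phi (fst y)] over this family is the variation of [phi] on the
    complement of [F]. *)
Definition off_bumps (F : K -> Prop) (y : CK op * R) : Prop :=
  in_unit_ball (fst y) /\ vanishes_near (fst y) F /\ snd y = 0.

Lemma off_bumps_nonempty F : exists y, off_bumps F y.
Proof.
exists (ck_const 0, 0); repeat split.
- intro k; change (Rabs 0 <= 1); rewrite Rabs_R0; lra.
- exists (fun _ => True); repeat split; apply (top_full _ Htop).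
Qed.

Lemma off_bumps_bound F y phi : off_bumps F y -> dual_ball op phi -> Rabs (phi (fst y) - snd y) <= 3.
Proof.
intros (H1 & _ & ->) [_ B]; rewrite Rminus_0_r; specialize (B _ H1); lra.
Qed.

(** [G] contains the support of the bump [y]. If [z] vanishes near [F] and [G], then [y + z] is
    again a competitor, so near maximality of [y] bounds [phi z]. *)
Lemma small_of_nearly_max F y k : off_bumps F y -> exists G,
  closed G /\ (forall x, F x -> ~ G x) /\
  forall phi, is_linear phi -> nearly_max (off_bumps F) y k phi -> small phi (fun x => F x \/ G x) k.
Proof.
intros (Hy & (U & HU & FU & EU) & Sy); exists (fun x => ~ U x); repeat split.
- now apply closed_complement.
- intros x Fx N; exact (N (FU x Fx)).
- intros phi Lphi N z Hz (V & HV & SV & EV).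
  assert (B : off_bumps F (ck_add (fst y) z, 0)).
  { repeat split; simpl.
    - intro x; change (Rabs (ck_fun (fst y) x + ck_fun z x) <= 1).
      destruct (classic (U x)) as [Ux|Ux].
      + rewrite (EU x Ux), Rplus_0_l; apply Hz.
      + rewrite (EV x); [rewrite Rplus_0_r; apply Hy|auto].
    - exists (fun x => U x /\ V x); repeat split; [now apply (top_inter _ Htop)|auto|auto|].
      intros x [Ux Vx]; change (ck_fun (fst y) x + ck_fun z x = 0).
      rewrite (EU x Ux), (EV x Vx); ring. }
  specialize (N _ B); simpl in N.
  rewrite (lin_comb phi 1 1 (fst y) z (ck_add (fst y) z) Lphi) in N; [rewrite Sy in N; lra|].
  intro x; change (ck_fun (fst y) x + ck_fun z x = 1 * ck_fun (fst y) x + 1 * ck_fun z x); ring.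
Qed.

(** With no exceptional set, closeness is norm distance at most [e < eps], so one derivation removes
    the whole slice. *)
Lemma kill_empty eps e r tau : e < eps -> 0 < tau -> kill eps (conc (fun _ => False) e) oone tau r.
Proof.
intros He Htau L Q t HL _ HE phi [Lphi N].
destruct (Rle_or_lt (phi Q) t) as [H|H]; [lra|exfalso; apply N].
exists Q, t; split; [now exists phi|split; [|now split]].
exists e; split; [easy|]; intros p q [Lp Qp] [Lq Qq] f Hf.
assert (V : forall z, vanishes_near z (fun _ => False)).
{ intro z; exists (fun _ => False); repeat split; try easy.
  apply op_ext with (1 := closed_full); tauto. }
pose proof (HE p q Lp Lq Qp Qq f Hf (V f)) as A.
pose proof (HE q p Lq Lp Qq Qp f Hf (V f)) as B.
apply Rabs_le; lra.
Qed.

(** * Finite exceptional sets *)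

Definition conc_points (m : nat) (e : R) (E : (CK op -> R) -> (CK op -> R) -> Prop) : Prop :=
  exists l, length l = m /\ E = conc (fun x => In x l) e.

(** Intermediate between [m + 1] and [m] points: [p] is separated from the rest of the mass, so that
    a bump at [p] can read off the atom. *)
Definition conc_points_isolated (m : nat) (e k : R) (E : (CK op -> R) -> (CK op -> R) -> Prop) : Prop :=
  exists p l G, length l = m /\ closed G /\ ~ G p /\
    E = fun phi psi => conc (fun x => In x (p :: l)) e phi psi /\
          small phi (fun x => x = p \/ G x) k /\ small psi (fun x => x = p \/ G x) k.

(* On [{phi f ~ phi' f}] the atoms at [p] of [phi] and [phi'] nearly agree, as [f] is 1 near [p] and both functionals
   have little mass on the rest of its support. *)
Lemma conc_remove_point phi psi p l G f e s :
  0 < s -> dual_ball op phi -> dual_ball op psi ->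
  conc (fun x => In x (p :: l)) e phi psi ->
  small phi (fun x => x = p \/ G x) s -> small psi (fun x => x = p \/ G x) s ->
  (forall x, 0 <= ck_fun f x <= 1) -> vanishes_near f G ->
  (exists V, op V /\ V p /\ forall x, V x -> ck_fun f x = 1) ->
  Rabs (phi f - psi f) <= 2 * s ->
  conc (fun x => In x l) (e + 6 * s) phi psi.
Proof.
intros Hs Bphi Bpsi HC S1 S2 Rf (N & HN & GN & EN) (V & HV & Vp & EV) Hf z Hz (N' & HN' & LN & EN').
assert (Bphi' := Bphi); assert (Bpsi' := Bpsi); destruct Bphi' as [L1 _], Bpsi' as [L2 _].
set (c := ck_fun z p).
assert (Hc : Rabs c <= 1) by apply Hz.
set (O := fun x => V x /\ Rabs (ck_fun z x - c) < s).
assert (HO : op O) by (apply (top_inter _ Htop); [easy|apply op_near, (proj2_sig z)]).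
assert (Op : O p) by (split; [easy|unfold c; rewrite Rminus_diag, Rabs_R0; lra]).
destruct (separating_function (fun x => ~ O x) (fun x => x = p))
  as (h & Rh & (U & HU & OU & EU) & (P & HP & pP & EP)).
- now apply closed_complement.
- apply closed_point.
- now intros x NO ->.
(* Write [z = z1 + z2 + c f - g]. Here [z1] vanishes near [p] and [l] and contributes [e]; [z2] has
   norm at most [s] and contributes [2 s]; [c f] contributes [2 s]; [g] vanishes near [p] and [G]
   and contributes [s] for each functional. *)
- set (z1 := ck_mul (ck_compl h) z).
  set (z2 := ck_mul h (ck_add z (ck_const (- c)))).
  set (g := ck_scale c (ck_add f (ck_scale (-1) h))).
  assert (H0 : forall x, ~ O x -> ck_fun h x = 0) by (intros x Ox; apply EU, OU, Ox).
  assert (D : forall th, is_linear th -> th z = th z1 + th z2 + c * th f - th g).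
  { intros th L.
    set (w := ck_add (ck_scale c f) (ck_scale (-1) g)).
    rewrite (lin_comb th 1 1 z1 (ck_add z2 w) z L).
    - rewrite (lin_comb th 1 1 z2 w (ck_add z2 w) L), (lin_comb th c (-1) f g w L); [ring|reflexivity|].
      intro x; change (ck_fun z2 x + ck_fun w x = 1 * ck_fun z2 x + 1 * ck_fun w x); ring.
    - intro x.
      change (ck_fun z x = 1 * (ck_fun (ck_compl h) x * ck_fun z x) + 1 * (ck_fun h x * (ck_fun z x + - c) +
        (c * ck_fun f x + -1 * (c * (ck_fun f x + -1 * ck_fun h x))))).
      rewrite ck_complE; ring. }
  assert (A1 : phi z1 - psi z1 <= e).
  { apply HC.
    - apply in_unit_ball_mul; [intro x; rewrite ck_complE; specialize (Rh x); lra|easy].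
    - exists (fun x => P x \/ N' x); split; [now apply op_union2|split].
      + intros x [<-|Hx]; [left; now apply pP|right; now apply LN].
      + intros x Hx; change (ck_fun (ck_compl h) x * ck_fun z x = 0); rewrite ck_complE.
        destruct Hx as [Px|Nx]; [rewrite (EP x Px)|rewrite (EN' x Nx)]; ring. }
  assert (A2 : forall x, Rabs (ck_fun z2 x) <= s).
  { intro x; change (Rabs (ck_fun h x * (ck_fun z x + - c)) <= s).
    destruct (classic (O x)) as [Ox|Ox].
    - destruct Ox as [_ Ox]; unfold Rminus in Ox; rewrite Rabs_mult, (Rabs_right (ck_fun h x)); [|specialize (Rh x); lra].
      specialize (Rh x); pose proof (Rabs_pos (ck_fun z x + - c)); nra.
    - rewrite (H0 x Ox), Rmult_0_l, Rabs_R0; lra. }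
  pose proof (Rabs_le_bounds _ _ (dual_ball_bound phi z2 s Bphi Hs A2)) as B1.
  pose proof (Rabs_le_bounds _ _ (dual_ball_bound psi z2 s Bpsi Hs A2)) as B2.
  assert (Bg : in_unit_ball g).
  { intro x; change (Rabs (c * (ck_fun f x + -1 * ck_fun h x)) <= 1).
    rewrite Rabs_mult.
    assert (Rabs (ck_fun f x + -1 * ck_fun h x) <= 1) by (specialize (Rf x); specialize (Rh x); apply Rabs_le; lra).
    pose proof (Rabs_pos c); pose proof (Rabs_pos (ck_fun f x + -1 * ck_fun h x)); nra. }
  assert (Vg : vanishes_near g (fun x => x = p \/ G x)).
  { exists (fun x => (P x /\ V x) \/ N x); split; [|split].
    - apply op_union2; [now apply (top_inter _ Htop)|easy].
    - intros x [->|Gx]; [left; split; auto|right; auto].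
    - intros x Hx; change (c * (ck_fun f x + -1 * ck_fun h x) = 0).
      destruct Hx as [[Px Vx]|Nx]; [rewrite (EP x Px), (EV x Vx); ring|].
      rewrite (EN x Nx), (H0 x); [ring|].
      intros [Vx _]; specialize (EN x Nx); rewrite (EV x Vx) in EN; lra. }
  pose proof (S1 _ (unit_ball_opp g Bg) (vanishes_near_scale (-1) g _ Vg)) as C1.
  rewrite (lin_scale phi _ _ L1) in C1.
  pose proof (S2 g Bg Vg) as C2.
  rewrite (D phi L1), (D psi L2).
  apply Rabs_le_bounds in Hf; apply Rabs_le_bounds in Hc.
  assert (c * (phi f - psi f) <= 2 * s) by nra.
  lra.
Qed.

Lemma uniformly_killed_isolated eps m e k : 0 < k <= 1 -> uniformly_killed eps (conc_points m (e + 6 * k)) oone ->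
  uniformly_killed eps (conc_points_isolated m e k) oone.
Proof.
intros Hk H tau r Htau.
(* As [v^2 - (2 u v - u^2) = (v - u)^2], tolerance [k^2] pins [phi f] to within [k] of [u], and two
   such functionals differ by at most [2 k] at [f]. *)
assert (Hkk : 0 < k * k <= 1) by nra.
destruct (potential_step eps _ oone (k * k) Hkk H tau r Htau) as [M HM].
exists M; intros E (p & l & G & Hl & HG & Gp & ->).
destruct (separating_function G (fun x => x = p)) as (f & Rf & Vf & (V & HV & pV & EV)); auto.
{ apply closed_point. }
{ now intros x Gx ->. }
assert (Bf : in_unit_ball f) by (intro x; apply Rabs_le; specialize (Rf x); lra).
(* [2 u v - u^2 <= v^2] with equality at [u = v]: the potential is [Q + a (phi f)^2]. *)
apply (HM _ (fun y => exists u, Rabs u <= 1 /\ y = (ck_scale (2 * u) f, u * u))).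
- exists (ck_scale (2 * 0) f, 0 * 0), 0; split; [rewrite Rabs_R0; lra|easy].
- intros y phi (u & Hu & ->) [L B]; simpl; rewrite (lin_scale phi _ _ L).
  specialize (B f Bf); apply Rabs_le_bounds in B; apply Rabs_le_bounds in Hu; apply Rabs_le; nra.
- intros y (u & Hu & ->); exists (conc (fun x => In x l) (e + 6 * k)); split; [now exists l|].
  assert (N : forall phi, dual_ball op phi ->
    nearly_max (fun y => exists u, Rabs u <= 1 /\ y = (ck_scale (2 * u) f, u * u)) (ck_scale (2 * u) f, u * u) (k * k) phi ->
    - k <= phi f - u <= k).
  { intros phi [L B] N; assert (Bv := B f Bf).
    specialize (N (ck_scale (2 * phi f) f, phi f * phi f)); simpl in N.
    rewrite !(lin_scale phi _ _ L) in N.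
    assert ((phi f - u) * (phi f - u) <= k * k) by (enough (2 * phi f * phi f - phi f * phi f <= 2 * u * phi f - u * u + k * k) by nra; apply N; now exists (phi f)).
    split; nra. }
  intros phi psi Bphi Bpsi (HC & S1 & S2) N1 N2.
  apply N in N1; [|easy]; apply N in N2; [|easy].
  apply conc_remove_point with p G f; auto; [lra|exists V; auto|apply Rabs_le; lra].
Qed.

(** Each point is removed by two potentials: the variation off [p] isolates the atom, then the
    square potential fixes its size. *)
Lemma uniformly_killed_points eps m : forall e, e < eps -> uniformly_killed eps (conc_points m e) oone.
Proof.
induction m as [|m IH]; intros e He.
- intros tau r Htau; exists 1%nat; intros E (l & Hl & ->).
  destruct l; [|easy]; now apply kill_empty.
(* The eighth keeps [e + 6 k] below [eps]. *)
- intros tau r Htau; set (k := Rmin 1 ((eps - e) / 8)).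
  assert (Hk : 0 < k <= 1) by (split; [apply Rmin_pos; lra|apply Rmin_l]).
  assert (Hk' : k <= (eps - e) / 8) by apply Rmin_r.
  assert (HU : uniformly_killed eps (conc_points_isolated m e k) oone)
    by (apply uniformly_killed_isolated; [easy|apply IH; lra]).
  destruct (potential_step eps _ oone k Hk HU tau r Htau) as [M HM].
  exists M; intros E (l & Hl & ->); destruct l as [|p l]; [easy|injection Hl as Hl].
  apply (HM _ (off_bumps (fun x => x = p))); [apply off_bumps_nonempty|apply off_bumps_bound|].
  intros y Hy; destruct (small_of_nearly_max _ y k Hy) as (G & HG & pG & SG).
  eexists; split; [exists p, l, G; repeat split; auto|].
  intros phi psi [L1 _] [L2 _] HC N1 N2; simpl; auto.
Qed.

(** * Induction on the Cantor-Bendixson rank *)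

Definition conc_rank (s : Ord) (n : nat) (e : R) (E : (CK op -> R) -> (CK op -> R) -> Prop) : Prop :=
  exists W, closed W /\ (forall x, ~ titer (cb_deriv op) W (omul s (ofin n)) x) /\ E = conc W e.

(** With [F] the last nonempty block derivative allowed, the variation off [F] confines the
    difference to [W] within [F] and a disjoint closed [G], a set of rank one block lower; the error
    grows by [2 k]. *)
Lemma uniformly_killed_rank eps s g :
  (forall e, e < eps -> uniformly_killed eps (conc_rank s 1 e) g) ->
  forall n e, e < eps -> uniformly_killed eps (conc_rank s (S n) e) g.
Proof.
intros H1 n; induction n as [|n IH]; intros e He; [now apply H1|].
intros tau r Htau; set (k := Rmin 1 ((eps - e) / 4)).
assert (Hk : 0 < k <= 1) by (split; [apply Rmin_pos; lra|apply Rmin_l]).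
assert (Hk' : k <= (eps - e) / 4) by apply Rmin_r.
destruct (potential_step eps _ g k Hk (IH (e + 2 * k) ltac:(lra)) tau r Htau) as [M HM].
exists M; intros E (W & HW & EW & ->).
set (F := titer (cb_deriv op) W (omul s (ofin (S n)))).
assert (HF : closed F) by now apply closed_titer_cb.
apply (HM _ (off_bumps F)); [apply off_bumps_nonempty|apply off_bumps_bound|].
intros y Hy; destruct (small_of_nearly_max _ y k Hy) as (G & HG & FG & SG).
exists (conc (fun x => W x /\ (F x \/ G x)) (e + 2 * k)); split.
- exists (fun x => W x /\ (F x \/ G x)); repeat split.
  + apply closed_inter; [easy|now apply closed_union].
  (* Such an [x] lies in [F], hence off [G], and near [x] the smaller set is contained in [F]. So
     [x] is in the derived set of [F] of order [s], which is that of [W] of order [s (n + 2)], and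
     this is empty. *)
  + intros x Hx.
    assert (Fx : F x) by (apply titer_subset with (3 := Hx); [apply cb_deriv_mono|now intros z [Wz _]]).
    apply (EW x); change (titer (cb_deriv op) W (oadd (omul s (ofin (S n))) s) x).
    rewrite titer_oadd; fold F.
    apply titer_cb_antitone with (omul s (ofin (S n))); [easy| |].
    * apply ole_trans with (omul s (ofin 1)); [apply omul_one|apply omul_ofin_mono; lia].
    * refine (titer_cb_local (fun z => ~ G z) _ F _ HG _ x (FG x Fx) Hx).
      intros z Gz [_ [Fz|Gz']]; [easy|contradiction].
- intros phi psi [L1 _] [L2 _] HC N1 N2.
  apply (small_inter (fun f => phi f - psi f) W (fun x => F x \/ G x) e (2 * k)); auto.
  + now apply lin_sub.
  + now apply closed_union.
  + apply conc_of_small; auto.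
Qed.

(** In the base case [W] is finite, and [omega] covers every finite number of derivations that may
    be required: this is the 1 in [1 + alpha]. At successors compactness leaves finitely many blocks
    of order [omega^alpha]; at limits it selects a member of the sequence. *)
Lemma kill_rank eps alpha : forall W e tau r, e < eps -> 0 < tau -> closed W ->
  (forall x, ~ titer (cb_deriv op) W (oexp omega alpha) x) ->
  kill eps (conc W e) (oexp omega (oadd oone alpha)) tau r.
Proof.
induction alpha as [|alpha IH|f IH]; intros W e tau r He Htau HW EW.
- destruct (discrete_closed_finite W EW) as [l Hl].
  destruct (uniformly_killed_points eps (length l) e He tau r Htau) as [M HM].
  apply kill_weaken with (conc (fun x => In x l) e).
  + intros phi psi; now apply small_mono.
  + apply kill_later with (omul oone (ofin M)); [|apply HM; now exists l].
    apply (ole_sup (fun n => omul (oadd OZ oone) (ofin n)) M).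
- destruct (compact_chain (fun n => titer (cb_deriv op) W (omul (oexp omega alpha) (ofin n)))) as [n Hn].
  + intro n; now apply closed_titer_cb.
  + intros m n; destruct (Nat.le_ge_cases m n) as [H|H]; [right|left]; intro x;
      apply titer_cb_antitone; auto; now apply omul_ofin_mono.
  + intro x; now apply not_all_ex_not, EW.
  + assert (Hn' : forall x, ~ titer (cb_deriv op) W (omul (oexp omega alpha) (ofin (S n))) x).
    { intros x Hx; apply (Hn x); revert Hx; apply titer_cb_antitone; auto; apply omul_ofin_mono; lia. }
    destruct (uniformly_killed_rank eps (oexp omega alpha) (oexp omega (oadd oone alpha))) with (n := n) (e := e) (tau := tau) (r := r)
      as [M HM]; auto.
    * intros e' He' tau' r' Htau'; exists 1%nat; intros E (W' & HW' & EW' & ->).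
      apply kill_later with (oexp omega (oadd oone alpha)); [apply omul_one|].
      apply IH; auto; intros x Hx; apply (EW' x); revert Hx; apply titer_cb_antitone; auto; apply omul_one.
    * apply kill_later with (omul (oexp omega (oadd oone alpha)) (ofin M)); [|apply HM; now exists W].
      apply (ole_sup (fun n => omul (oexp omega (oadd oone alpha)) (ofin n)) M).
- destruct (compact_chain (fun n => titer (cb_deriv op) W (oexp omega (f n)))) as [n Hn].
  + intro n; now apply closed_titer_cb.
  + intros m n; destruct (ole_total (oexp omega (f m)) (oexp omega (f n))) as [H|H]; [right|left];
      intro x; now apply titer_cb_antitone.
  + intro x; now apply not_all_ex_not, EW.
  + apply kill_later with (oexp omega (oadd oone (f n))); [|now apply IH].
    apply (ole_sup (fun n => oexp omega (oadd oone (f n))) n).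
Qed.

Lemma titer_d_empty eps alpha : 0 < eps -> (forall x, ~ cb_set op (oexp omega alpha) x) ->
  forall phi, ~ titer (d_eps eps) (dual_ball op) (oexp omega (oadd oone alpha)) phi.
Proof.
intros Heps H phi Hphi.
(* For [Q = 0] and [t = -1] the slice is the whole ball, and off the full space all functionals
   agree. The resulting bound [0 <= -1/2] is absurd. *)
assert (B : phi (ck_const 0) <= -1 + 1 / 2).
{ apply (kill_rank eps alpha (fun _ => True) 0 (1 / 2) 2) with (L := dual_ball op); auto; try lra.
  - apply closed_full.
  - intros p [L _]; rewrite (lin_ext p _ (ck_scale 0 (ck_const 0)) L), (lin_scale p _ _ L); [lra|].
    intro x; change (0 = 0 * 0); ring.
  - intros p q [L1 _] [L2 _] _ _ z _ (U & _ & FU & EU).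
    rewrite (lin_ext p z (ck_scale 0 z) L1), (lin_ext q z (ck_scale 0 z) L2), (lin_scale p _ _ L1), (lin_scale q _ _ L2); [lra| |];
      intro x; rewrite (EU x (FU x I)); change (0 = 0 * ck_fun z x); ring. }
destruct (titer_d_subset _ _ _ _ Hphi) as [L _].
rewrite (lin_ext phi _ (ck_scale 0 (ck_const 0)) L), (lin_scale phi _ _ L) in B; [lra|].
intro x; change (0 = 0 * 0); ring.
Qed.

(** * Lower bound *)

(** Closedness is tested on one function at a time; by Hahn-Banach separation, weak*-closed convex
    subsets of the ball satisfy this. *)
Record good (L : (CK op -> R) -> Prop) : Prop := {
  good_ball : forall phi, L phi -> dual_ball op phi;
  good_closed : forall phi, dual_ball op phi ->
    (forall f eta, 0 < eta -> exists psi, L psi /\ Rabs (phi f - psi f) < eta) -> L phi;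
  good_mid : forall phi psi, L phi -> L psi -> L (fun f => (phi f + psi f) / 2) }.

Lemma good_dual_ball : good (dual_ball op).
Proof.
split; auto.
intros phi psi [[A1 A2] A3] [[B1 B2] B3]; split; [split|].
- intros f g h E; rewrite (A1 f g h E), (B1 f g h E); field.
- intros c f h E; rewrite (A2 c f h E), (B2 c f h E); field.
- intros f Hf; specialize (A3 f Hf); specialize (B3 f Hf).
  apply Rabs_le_bounds in A3; apply Rabs_le_bounds in B3; apply Rabs_le; lra.
Qed.

(** A slice containing [phi] also contains the elements close to [phi] at its one defining function,
    and a slice containing a midpoint contains an endpoint. *)
Lemma good_d_eps eps L : good L -> good (d_eps eps L).
Proof.
intros [G1 G2 G3]; split.
- intros phi [H _]; auto.
- intros phi B H.
  assert (Lphi : L phi).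
  { apply G2; auto; intros f eta He; destruct (H f eta He) as (psi & [Lp _] & Hp); eauto. }
  split; [easy|intros (x & t & _ & D & [_ Hx])].
  destruct (H x (phi x - t)) as (psi & [Lp N] & Hp); [lra|].
  apply Rabs_def2 in Hp; apply N; exists x, t.
  assert (slice L x t psi) by (split; [easy|lra]).
  split; [now exists psi|auto].
- intros phi psi [H1 N1] [H2 N2]; split; [auto|].
  intros (x & t & _ & D & [_ Hx]).
  destruct (Rle_or_lt (phi x) t) as [A|A].
  + apply N2; exists x, t; assert (slice L x t psi) by (split; [easy|lra]).
    split; [now exists psi|auto].
  + apply N1; exists x, t; assert (slice L x t phi) by (split; [easy|lra]).
    split; [now exists phi|auto].
Qed.

Lemma good_titer eps L b : good L -> good (titer (d_eps eps) L b).
Proof.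
intro G; induction b as [|b IH|f IH]; simpl; [easy|now apply good_d_eps|].
split.
- intros phi H; exact (good_ball _ (IH 0%nat) phi (H 0%nat)).
- intros phi B H n; apply (good_closed _ (IH n)); [easy|].
  intros g eta He; destruct (H g eta He) as (psi & Hp & E); exists psi; auto.
- intros phi psi H1 H2 n; apply (good_mid _ (IH n)); auto.
Qed.

Definition sum_at (l : list K) (f : CK op) : R := fold_right (fun y s => ck_fun f y + s) 0 l.

Lemma sum_at_app l m f : sum_at (l ++ m) f = sum_at l f + sum_at m f.
Proof. induction l as [|y l IH]; simpl; [ring|rewrite IH; ring]. Qed.

Lemma sum_at_near l f a e : (forall y, In y l -> Rabs (ck_fun f y - a) <= e) ->
  Rabs (sum_at l f - a * INR (length l)) <= e * INR (length l).
Proof.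
induction l as [|y l IH]; intro H.
- simpl; rewrite !Rmult_0_r, Rminus_0_r, Rabs_R0; lra.
- assert (A := H y (or_introl eq_refl)).
  assert (B := IH (fun z Hz => H z (or_intror Hz))).
  apply Rabs_le_bounds in A; apply Rabs_le_bounds in B.
  change (length (y :: l)) with (S (length l)); rewrite S_INR; simpl; apply Rabs_le; lra.
Qed.

Lemma sum_at_const l f a : (forall y, In y l -> ck_fun f y = a) -> sum_at l f = a * INR (length l).
Proof.
intro H; assert (A := sum_at_near l f a 0).
rewrite Rmult_0_l in A; enough (Rabs (sum_at l f - a * INR (length l)) <= 0) as B.
- apply Rabs_le_bounds in B; lra.
- apply A; intros y Hy; rewrite (H y Hy), Rminus_diag, Rabs_R0; lra.
Qed.

(* The averages form a dyadic tree whose siblings are 2|r| apart, so an average of 2^n points survives n derivations. *)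
Lemma average_in eps M nu r (A : K -> Prop) : good M -> eps <= Rabs r ->
  (forall y, A y -> M (fun f => nu f + r * ck_fun f y)) ->
  forall n l, length l = (2 ^ n)%nat -> NoDup l -> (forall y, In y l -> A y) ->
  titer (d_eps eps) M (ofin n) (fun f => nu f + r / 2 ^ n * sum_at l f).
Proof.
intros GM Hr HA n; induction n as [|n IH]; intros l Hl ND Al.
- destruct l as [|y [|? ?]]; try easy.
  replace (fun f => nu f + r / 2 ^ 0 * sum_at (y :: nil) f) with (fun f => nu f + r * ck_fun f y).
  + apply HA, Al; now left.
  + extensionality f; simpl; field.
- assert (P2 : 2 ^ n <> 0) by (apply pow_nonzero; lra).
  set (l1 := firstn (2 ^ n) l); set (l2 := skipn (2 ^ n) l).
  assert (El : l = l1 ++ l2) by (symmetry; apply firstn_skipn).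
  assert (Hl1 : length l1 = (2 ^ n)%nat) by (unfold l1; rewrite length_firstn, Hl; simpl; lia).
  assert (Hl2 : length l2 = (2 ^ n)%nat) by (unfold l2; rewrite length_skipn, Hl; simpl; lia).
  assert (I1 : INR (length l1) = 2 ^ n) by (rewrite Hl1, pow_INR; reflexivity).
  assert (I2 : INR (length l2) = 2 ^ n) by (rewrite Hl2, pow_INR; reflexivity).
  clearbody l1 l2; subst l.
  assert (T1 := IH l1 Hl1 (NoDup_app_remove_r _ _ ND) (fun y H => Al y (in_or_app _ _ _ (or_introl H)))).
  assert (T2 := IH l2 Hl2 (NoDup_app_remove_l _ _ ND) (fun y H => Al y (in_or_app _ _ _ (or_intror H)))).
  set (a := fun f => nu f + r / 2 ^ n * sum_at l1 f) in *.
  set (b := fun f => nu f + r / 2 ^ n * sum_at l2 f) in *.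
  replace (fun f => nu f + r / 2 ^ S n * sum_at (l1 ++ l2) f) with (fun f => (a f + b f) / 2).
  2: { extensionality f; unfold a, b; rewrite sum_at_app; simpl; field; easy. }
  destruct (separating_function (fun x => In x l1) (fun x => In x l2)) as (h & Rh & (U & _ & LU & EU) & (V & _ & LV & EV)).
  { apply closed_list. } { apply closed_list. }
  { intros x H1 H2; revert ND H1 H2; clear; induction l1 as [|y l IH]; [easy|].
    simpl; intros ND [->|H1] H2; apply NoDup_cons_iff in ND; destruct ND as [N ND]; [|auto].
    apply N, in_or_app; now right. }
  (* [f] is -1 on [l1] and 1 on [l2]. A slice around the midpoint contains [a] or [b], and at [f]
     either differs from the midpoint by [|r| >= eps]. *)
  set (f := ck_add (ck_const (-1)) (ck_scale 2 h)).
  assert (Ef : forall x, ck_fun f x = 2 * ck_fun h x - 1) by (intro x; change (-1 + 2 * ck_fun h x = 2 * ck_fun h x - 1); ring).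
  assert (Bf : in_unit_ball f) by (intro x; rewrite Ef; specialize (Rh x); apply Rabs_le; lra).
  assert (S1 : sum_at l1 f = - 2 ^ n).
  { rewrite (sum_at_const l1 f (-1)), I1; [ring|]; intros y Hy; rewrite Ef, (EU y (LU y Hy)); ring. }
  assert (S2 : sum_at l2 f = 2 ^ n).
  { rewrite (sum_at_const l2 f 1), I2; [ring|]; intros y Hy; rewrite Ef, (EV y (LV y Hy)); ring. }
  assert (Ea : (a f + b f) / 2 - a f = r) by (unfold a, b; rewrite S1, S2; field; easy).
  assert (Eb : (a f + b f) / 2 - b f = - r) by (unfold a, b; rewrite S1, S2; field; easy).
  split; [now apply good_mid; [apply good_titer|..]|].
  intros (x & t & _ & (dl & Hd & D) & Sm).
  destruct (Rle_or_lt (a x) t) as [H|H].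
  + assert (Sb : slice (titer (d_eps eps) M (ofin n)) x t b) by (split; [easy|destruct Sm as [_ Sm]; lra]).
    specialize (D _ _ Sm Sb f Bf); simpl in D; rewrite Eb, Rabs_Ropp in D; lra.
  + assert (Sa : slice (titer (d_eps eps) M (ofin n)) x t a) by now split.
    specialize (D _ _ Sm Sa f Bf); simpl in D; rewrite Ea in D; lra.
Qed.

Lemma delta_in eps L nu r : good L -> eps <= Rabs r ->
  (forall y, L (fun f => nu f + r * ck_fun f y)) ->
  forall b x, cb_set op b x -> titer (d_eps eps) L (omul omega b) (fun f => nu f + r * ck_fun f x).
Proof.
intros GL Hr HL b; induction b as [|b IH|g IH]; intros x Hx.
- apply HL.
- change (titer (d_eps eps) L (oadd (omul omega b) omega) (fun f => nu f + r * ck_fun f x)).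
  rewrite titer_oadd; intro n; set (M := titer (d_eps eps) L (omul omega b)) in *.
  assert (GM : good M) by now apply good_titer.
  apply (good_closed _ (good_titer eps M (ofin n) GM)); [apply (good_ball L GL), HL|].
  intros f eta He; pose proof (Rabs_pos r) as Pr.
  set (e := eta / (Rabs r + 1)).
  assert (He' : 0 < e) by (apply Rdiv_lt_0_compat; lra).
  assert (Hre : Rabs r * e < eta).
  { replace eta with ((Rabs r + 1) * e) at 1 by (unfold e; field; lra); lra. }
  destruct (accumulation_list _ x (2 ^ n) _ Hx (op_near (ck_fun f) (ck_fun f x) e (proj2_sig f))) as (l & Hl & ND & Al).
  { rewrite Rminus_diag, Rabs_R0; lra. }
  exists (fun f => nu f + r / 2 ^ n * sum_at l f); split.
  + apply (average_in eps M nu r (cb_set op b)); auto; intros y Hy; now apply Al.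
  + assert (B : Rabs (sum_at l f - ck_fun f x * INR (length l)) <= e * INR (length l)).
    { apply sum_at_near; intros y Hy; left; now apply Al. }
    rewrite Hl, pow_INR in B; change (INR 2) with 2 in B.
    assert (P2 : 0 < 2 ^ n) by (apply pow_lt; lra).
    replace (nu f + r * ck_fun f x - (nu f + r / 2 ^ n * sum_at l f))
      with (- (r * ((sum_at l f - ck_fun f x * 2 ^ n) / 2 ^ n))) by (field; lra).
    unfold Rdiv; rewrite Rabs_Ropp, !Rabs_mult, Rabs_inv, (Rabs_right (2 ^ n)); [|lra].
    apply Rle_lt_trans with (2 := Hre), Rmult_le_compat_l; [easy|].
    apply Rmult_le_reg_r with (2 ^ n); [easy|].
    rewrite Rmult_assoc, Rinv_l; lra.
- intro n; apply IH, Hx.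
Qed.

Lemma center_in eps L nu r b : good L -> 0 < eps <= r -> (exists x, cb_set op b x) ->
  (forall y, L (fun f => nu f + r * ck_fun f y)) -> (forall y, L (fun f => nu f + - r * ck_fun f y)) ->
  titer (d_eps eps) L (omul omega b) nu.
Proof.
intros GL Hr [x Hx] H1 H2.
replace nu with (fun f => ((nu f + r * ck_fun f x) + (nu f + - r * ck_fun f x)) / 2) by (extensionality f; field).
apply (good_mid _ (good_titer eps L _ GL) (fun f => nu f + r * ck_fun f x) (fun f => nu f + - r * ck_fun f x));
  apply delta_in; auto; [|rewrite Rabs_Ropp]; rewrite Rabs_right; lra.
Qed.

Lemma scaled_ball_in N b : (exists x, cb_set op b x) -> (0 < N)%nat ->
  forall k phi, (k <= N)%nat -> is_linear phi ->
    (forall f, in_unit_ball f -> Rabs (phi f) <= 1 - INR k / INR N) ->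
    titer (d_eps (/ INR N)) (dual_ball op) (omul (omul omega b) (ofin k)) phi.
Proof.
intros Hb HN.
assert (PN : 0 < INR N) by now apply lt_0_INR.
assert (PN' : 0 < / INR N) by now apply Rinv_0_lt_compat.
induction k as [|k IH]; intros phi Hk Lphi Bphi.
- split; [easy|]; intros f Hf; specialize (Bphi f Hf); simpl in Bphi; lra.
- change (titer (d_eps (/ INR N)) (dual_ball op) (oadd (omul (omul omega b) (ofin k)) (omul omega b)) phi).
  rewrite titer_oadd.
  (* Adding an atom of size at most [1/N] stays within radius [1 - k/N], where the induction
     hypothesis grants [k] blocks. *)
  assert (step : forall c y, Rabs c <= / INR N ->
    titer (d_eps (/ INR N)) (dual_ball op) (omul (omul omega b) (ofin k)) (fun f => phi f + c * ck_fun f y)).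
  { intros c y Hc; apply IH; [lia| |].
    - destruct Lphi as [A1 A2]; split.
      + intros f g h E; rewrite (A1 f g h E), (E y); ring.
      + intros c' f h E; rewrite (A2 c' f h E), (E y); ring.
    - intros f Hf; specialize (Bphi f Hf); specialize (Hf y); rewrite S_INR in Bphi.
      pose proof (Rabs_triang (phi f) (c * ck_fun f y)) as T; rewrite Rabs_mult in T.
      pose proof (Rabs_pos c); pose proof (Rabs_pos (ck_fun f y)).
      unfold Rdiv in *; nra. }
  apply center_in with (/ INR N); auto; [apply good_titer, good_dual_ball|lra| |];
    intro y; apply step; [|rewrite Rabs_Ropp]; rewrite Rabs_right; lra.
Qed.

Lemma titer_d_nonempty N b : (exists x, cb_set op b x) -> (0 < N)%nat ->
  exists phi, titer (d_eps (/ INR N)) (dual_ball op) (omul (omul omega b) (ofin N)) phi.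
Proof.
intros Hb HN; exists (fun _ => 0); apply scaled_ball_in; auto.
- split; intros; ring.
- intros f _; rewrite Rabs_R0; apply lt_0_INR in HN.
  right; field; lra.
Qed.

(** * The dentability index *)

Lemma Dz_eps_least eps g : (forall phi, ~ titer (d_eps eps) (dual_ball op) g phi) ->
  exists b, Dz_eps_is op eps b /\ ole b g.
Proof.
intro H.
destruct (ord_least (fun b => forall phi, ~ titer (d_eps eps) (dual_ball op) b phi) g) as (b & Hb & E & Mb).
{ exists g; split; [apply ole_refl|easy]. }
exists b; repeat split; auto.
intros mu Hmu; apply NNPP; intro N; apply (Mb mu Hmu); intros phi Hphi; apply N; now exists phi.
Qed.

Lemma Dz_eps_lower eps b c : Dz_eps_is op eps b ->
  (exists phi, titer (d_eps eps) (dual_ball op) c phi) -> ole c b.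
Proof.
intros [E _] [phi Hphi]; destruct (ole_olt_total c b) as [H|H]; [easy|exfalso].
apply (E phi), titer_d_antitone with c; [|easy].
apply ole_trans with (OS b); [apply ole_S|exact H].
Qed.

End Space.

Theorem mainTheorem12 (K : Type) (op : (K -> Prop) -> Prop)
  (Htop : is_topology op) (Hhaus : hausdorff op) (Hcomp : compact_sp op)
  (alpha : Ord)
  (Hne : exists x, cb_set op (oexp omega alpha) x)
  (Hem : forall x, ~ cb_set op (oexp omega (OS alpha)) x) :
  Dz_is op (oexp omega (oadd (oadd oone alpha) oone)).
Proof.
assert (least : forall eps, 0 < eps -> exists b, Dz_eps_is op eps b /\ ole b (oexp omega (oadd (oadd oone alpha) oone))).
{ intros eps Heps; apply Dz_eps_least.
  (* The exponents [1 + (alpha + 1)] and [(1 + alpha) + 1] are the same tree by computation. *)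
  exact (titer_d_empty Htop Hhaus Hcomp eps (OS alpha) Heps Hem). }
split; [exact least|].
(* The power computes to the supremum of [omega^(1 + alpha) * n]; each positive [n] is reached with
   [eps = 1/n]. *)
intros d Hd; apply ole_L_l; intros [|n]; [apply ole_Z|].
set (N := S n).
assert (PN : 0 < / INR N) by (apply Rinv_0_lt_compat, lt_0_INR; unfold N; lia).
destruct (least _ PN) as (b & Db & _).
apply ole_trans with b; [|now apply Hd with (1 := PN)].
apply ole_trans with (omul (omul omega (oexp omega alpha)) (ofin N)).
- apply omul_mono_l, omega_pow_one_add.
- apply Dz_eps_lower with (1 := Db), titer_d_nonempty; auto; unfold N; lia.
Qed.
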